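(* For all integers $s,t\geq 7$ there is a graph $G$ such that $\gamma'_{MB}(G)=s$ and $\gamma_{WC}(G)=t$.
   Context: The unbiased Maker-Breaker domination game on $G$: Dominator and Staller alternately claim one unclaimed vertex of $G$ each; Dominator wins if she claims all vertices of some dominating set. $\gamma'_{MB}(G)$ is the smallest number of rounds within which Dominator can always win when Staller starts the game ($\infty$ if she cannot win). The Waiter-Client domination game on $G$: in each round Dominator offers two unclaimed vertices, Staller picks one for himself and the other goes to Dominator (a single last remaining vertex goes to Staller); Dominator wins if she claims a dominating set. $\gamma_{WC}(G)$ is the smallest number of rounds within which Dominator can always occupy a dominating set in this game ($\infty$ if she cannot win). *)

(* Defs.v *)
From mathcomp Require Import all_boot.

Set Implicit Arguments.
Unset Strict Implicit.
Unset Printing Implicit Defensive.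

Record sgraph := SGraph {
  vertex :> finType;
  adj : rel vertex;
  adj_sym : symmetric adj;
  adj_irrefl : irreflexive adj
}.

Section Games.
Variable G : sgraph.
Implicit Types D S : {set G}.

Definition dominating D : bool :=
  [forall v, (v \in D) || [exists u in D, adj u v]].

(* In a position, D and S are the sets of vertices already claimed by
   Dominator and by Staller. *)
Definition unclaimed D S : {set G} := ~: (D :|: S).

(* Dominator, with Staller about to move, can force that she owns a dominating
   set after at most k further rounds (Staller claims x, Dominator claims y).
   The test [unclaimed D S != set0] is needed: when the board is full, the
   universal quantifier over Staller's moves would be vacuously true. *)
Fixpoint mb_wins (k : nat) D S : bool :=
  dominating D ||
  (if k is k'.+1 then
     (unclaimed D S != set0) &&
     [forall x in unclaimed D S, exists y in unclaimed D (x |: S),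
        mb_wins k' (y |: D) (x |: S)]
   else false).

(* Same for the Waiter-Client game: Dominator offers x and y, and must win
   whichever of them Staller keeps. If fewer than two vertices are unclaimed,
   Dominator claims nothing more, so she wins only if D already dominates. *)
Fixpoint wc_wins (k : nat) D S : bool :=
  dominating D ||
  (if k is k'.+1 then
     [exists x in unclaimed D S, exists y in unclaimed D S,
        [&& x != y, wc_wins k' (y |: D) (x |: S)
                  & wc_wins k' (x |: D) (y |: S)]]
   else false).

(* None stands for infinity. Searching up to #|G| loses nothing, see
   least_roundsP and least_rounds_infty below. *)
Definition least_rounds (wins : pred nat) : option nat :=
  ohead [seq k <- iota 0 #|G|.+1 | wins k].

Definition gammaMB' : option nat :=
  least_rounds (fun k => mb_wins k set0 set0).

Definition gammaWC : option nat :=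
  least_rounds (fun k => wc_wins k set0 set0).

Lemma unclaimed_move D S x y :
  x \in unclaimed D S -> y \in unclaimed D S -> x != y ->
  #|unclaimed (y |: D) (x |: S)|.+2 = #|unclaimed D S|.
Proof.
move=> xU yU nxy.
have -> : unclaimed (y |: D) (x |: S) = (unclaimed D S :\ x) :\ y.
  by apply/setP=> z; rewrite !inE; do 4 case: (_ \in _) || case: eqP.
rewrite (cardsD1 x (unclaimed D S)) xU (cardsD1 y (_ :\ x)) !inE eq_sym nxy.
by move: yU; rewrite !inE => ->.
Qed.

Lemma mb_wins_bound k m D S :
  mb_wins k D S -> #|unclaimed D S| <= m -> mb_wins m D S.
Proof.
elim: m k D S => [|m IHm] [|k] D S /=; rewrite ?orbF.
- by [].
- case/orP=> [-> //|/andP[ne _]]; rewrite leqn0 cards_eq0.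
  by rewrite (negbTE ne).
- by move->.
case/orP=> [-> //|/andP[ne /forall_inP win] le].
apply/orP; right; rewrite ne; apply/forall_inP=> x xU.
have /exists_inP[y yU wy] := win x xU; apply/exists_inP; exists y => //.
apply: (IHm k) => //; move: yU; rewrite !inE !negb_or => /and3P[yD yx yS].
have yU : y \in unclaimed D S by rewrite !inE negb_or yD.
have := unclaimed_move xU yU; rewrite eq_sym yx => /(_ isT) e.
by rewrite -e in le; apply: ltnW.
Qed.

Lemma wc_wins_bound k m D S :
  wc_wins k D S -> #|unclaimed D S| <= m -> wc_wins m D S.
Proof.
elim: m k D S => [|m IHm] [|k] D S /=; rewrite ?orbF.
- by [].
- case/orP=> [-> //|/exists_inP[x xU _]]; rewrite leqn0 cards_eq0.
  by move=> /eqP e; rewrite e inE in xU.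
- by move->.
case/orP=> [-> //|/exists_inP[x xU /exists_inP[y yU /and3P[nxy w1 w2]]] le].
apply/orP; right; apply/exists_inP; exists x => //; apply/exists_inP.
exists y => //; rewrite nxy /=; apply/andP; split; apply: (IHm k) => //.
  by apply: ltnW; rewrite -ltnS (unclaimed_move xU yU).
by apply: ltnW; rewrite -ltnS (unclaimed_move yU xU) // eq_sym.
Qed.

Lemma least_roundsP (wins : pred nat) (s : nat) :
  (forall k, wins k -> wins #|G|) ->
  least_rounds wins = Some s <-> wins s /\ (forall k, k < s -> ~~ wins k).
Proof.
move=> bnd; rewrite /least_rounds.
have aux a n : ohead [seq k <- iota a n | wins k] = Some s <->
    [/\ a <= s, s < a + n, wins s & forall k, a <= k < s -> ~~ wins k].
  elim: n a => [|n IHn] a /=.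
    by split=> [//|[h1 h2 _ _]]; rewrite addn0 ltnNge h1 in h2.
  case: ifP => wa /=.
    split=> [[<-]|[h1 _ ws h]].
      split=> //; first by rewrite addnS ltnS leq_addr.
      by move=> k /andP[h1 h2]; rewrite leqNgt h2 in h1.
    case: (ltngtP a s) h1 => // [lt|-> //] _.
    by have := h a; rewrite leqnn lt wa => /(_ isT).
  apply: (iff_trans (IHn _)); rewrite addSnnS; split=> -[h1 h2 ws h]; split=> //.
  - exact: ltnW.
  - move=> k; rewrite leq_eqVlt => /andP[/orP[/eqP <-|ak] ks]; first by rewrite wa.
    by apply: h; rewrite ak ks.
  - by rewrite ltn_neqAle h1 andbT; apply: contraFneq wa => ->.
  by move=> k /andP[/ltnW ak ks]; apply: h; rewrite ak ks.
apply: (iff_trans (aux _ _)); rewrite add0n; split=> [[_ _ ws h]|[ws h]]; first by split=> // k ks; apply: h.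
split=> //; rewrite ltnS leqNgt; apply/negP=> /h.
by rewrite (bnd s ws).
Qed.

Lemma least_rounds_infty (wins : pred nat) :
  (forall k, wins k -> wins #|G|) ->
  least_rounds wins = None <-> forall k, ~~ wins k.
Proof.
move=> bnd; rewrite /least_rounds; split=> [e k|h].
  apply/negP=> /bnd w.
  have : #|G| \in [seq k <- iota 0 #|G|.+1 | wins k].
    by rewrite mem_filter w mem_iota /= add0n ltnS.
  by case: [seq _ <- _ | _] e.
by rewrite (eq_filter (a2 := pred0)) ?filter_pred0 // => k; apply/negbTE.
Qed.

Lemma gammaMB'P s : gammaMB' = Some s <->
  mb_wins s set0 set0 /\ (forall k, k < s -> ~~ mb_wins k set0 set0).
Proof.
apply: (@least_roundsP (fun k => mb_wins k set0 set0)) => k w.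
exact: mb_wins_bound w (max_card _).
Qed.

Lemma gammaMB'_infty : gammaMB' = None <-> forall k, ~~ mb_wins k set0 set0.
Proof.
apply: (@least_rounds_infty (fun k => mb_wins k set0 set0)) => k w.
exact: mb_wins_bound w (max_card _).
Qed.

Lemma gammaWCP s : gammaWC = Some s <->
  wc_wins s set0 set0 /\ (forall k, k < s -> ~~ wc_wins k set0 set0).
Proof.
apply: (@least_roundsP (fun k => wc_wins k set0 set0)) => k w.
exact: wc_wins_bound w (max_card _).
Qed.

Lemma gammaWC_infty : gammaWC = None <-> forall k, ~~ wc_wins k set0 set0.
Proof.
apply: (@least_rounds_infty (fun k => wc_wins k set0 set0)) => k w.
exact: wc_wins_bound w (max_card _).
Qed.

End Games.

(* Main.v *)
Require Import Defs.
From mathcomp Require Import all_boot.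

(** Take a clique C and hang on it, for each set e in a list L of subsets of C,
    a "gadget": two adjacent new vertices, both joined to all of e. If C itself
    is in L, then Dominator's set is dominating iff, for every gadget, it
    contains a vertex of e or one of the two new vertices. Adding a gadget to L
    increases each of the two game parameters by 0 or 1, and adding a gadget
    with e empty (a component K_2) increases both by exactly 1.

    Let all sets e come from a fixed hypergraph E on C. If Dominator can meet
    all edges of E playing on C only, she wins in boundedly many rounds whatever
    the number of gadgets; if Staller can claim an edge of E, then Dominator
    must pay one round for each gadget on that edge. So if E is a win for
    Dominator in one of the two games and for Staller in the other one, then
    adding gadgets one by one makes the difference of the two parameters go
    through all values of one sign, while the smaller one stays at most 3;
    copies of K_2 then shift both parameters to their targets. Both kinds of E
    exist: the root-to-leaf paths of a binary tree of depth 2 are won by Staller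
    in the Maker-Breaker game but by Dominator in the Waiter-Client game, and
    [triangle_core], on 6 vertices, behaves the other way round. *)
Set Implicit Arguments.
Unset Strict Implicit.
Unset Printing Implicit Defensive.

Lemma disjoint_move (V : finType) (D S : {set V}) x y : [disjoint D & S] ->
  x \in ~: (D :|: S) -> y \in ~: (D :|: (x |: S)) ->
  [disjoint y |: D & x |: S].
Proof.
rewrite !inE !negb_or => dDS /andP[xD xS] /and3P[yD yx yS].
rewrite disjoints_subset; apply/subsetP=> z; rewrite !inE negb_or.
case/orP=> [/eqP->|zD]; first by rewrite yx.
by rewrite (disjointFr dDS zD) andbT; apply: contraNneq xD => <-.
Qed.

(** * The two games with an arbitrary goal *)

Section Goals.
Variables (V : finType) (goal : pred {set V}).
Implicit Types D S : {set V}.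

(** The goal is a parameter because removing a gadget changes both the board and the condition that
    Dominator has to meet. For the goal [dominating] this is [mb_wins] by conversion. *)
Fixpoint mb (k : nat) D S : bool :=
  goal D ||
  (if k is k'.+1 then
     (~: (D :|: S) != set0) &&
     [forall x in ~: (D :|: S), exists y in ~: (D :|: (x |: S)),
        mb k' (y |: D) (x |: S)]
   else false).

Fixpoint wc (k : nat) D S : bool :=
  goal D ||
  (if k is k'.+1 then
     [exists x in ~: (D :|: S), exists y in ~: (D :|: S),
        [&& x != y, wc k' (y |: D) (x |: S) & wc k' (x |: D) (y |: S)]]
   else false).

Lemma mb_goal k D S : goal D -> mb k D S.
Proof. by case: k => [|k] /= ->. Qed.

Lemma wc_goal k D S : goal D -> wc k D S.
Proof. by case: k => [|k] /= ->. Qed.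

Lemma mb_step k D S : ~: (D :|: S) != set0 ->
  (forall x, x \in ~: (D :|: S) ->
     exists2 y, y \in ~: (D :|: (x |: S)) & mb k (y |: D) (x |: S)) ->
  mb k.+1 D S.
Proof.
move=> ne h /=; rewrite ne; apply/orP; right.
by apply/forall_inP => x /h[y yU w]; apply/exists_inP; exists y.
Qed.

Lemma mbP k D S : mb k D S -> ~~ goal D ->
  exists2 k', k = k'.+1 & ~: (D :|: S) != set0 /\
    forall x, x \in ~: (D :|: S) ->
     exists2 y, y \in ~: (D :|: (x |: S)) & mb k' (y |: D) (x |: S).
Proof.
case: k => [|k] /=; first by rewrite orbF => ->.
case/orP => [-> //|/andP[ne /forall_inP h]] _; exists k => //; split=> // x /h.
by case/exists_inP => y; exists y.
Qed.

Lemma wc_step k D S x y : x \in ~: (D :|: S) -> y \in ~: (D :|: S) ->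
  x != y -> wc k (y |: D) (x |: S) -> wc k (x |: D) (y |: S) -> wc k.+1 D S.
Proof.
move=> xU yU nxy w1 w2 /=; apply/orP; right; apply/exists_inP; exists x => //.
by apply/exists_inP; exists y => //; rewrite nxy w1.
Qed.

Lemma wcP k D S : wc k D S -> ~~ goal D ->
  exists2 k', k = k'.+1 & exists x y, [/\ x \in ~: (D :|: S),
    y \in ~: (D :|: S), x != y, wc k' (y |: D) (x |: S)
    & wc k' (x |: D) (y |: S)].
Proof.
case: k => [|k] /=; first by rewrite orbF => ->.
case/orP => [-> //|/exists_inP[x xU /exists_inP[y yU /and3P[? ? ?]]]] _.
by exists k => //; exists x, y.
Qed.

Lemma mb_leq k m D S : k <= m -> mb k D S -> mb m D S.
Proof.
elim: k m D S => [|k IHk] m D S; first by rewrite /= orbF => _ /mb_goal.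
case: m => // m km; have [/mb_goal //|ng /mbP/(_ ng)[_ [<-] [ne h]]] := boolP (goal D).
by apply: mb_step => // x /h[y yU /IHk w]; exists y => //; apply: w.
Qed.

Lemma wc_leq k m D S : k <= m -> wc k D S -> wc m D S.
Proof.
elim: k m D S => [|k IHk] m D S; first by rewrite /= orbF => _ /wc_goal.
case: m => // m km; have [/wc_goal //|ng /wcP/(_ ng)[_ [<-]]] := boolP (goal D).
by case=> x [y [xU yU nxy w1 w2]]; apply: (wc_step xU yU nxy); apply: IHk.
Qed.

(** Let Staller take an arbitrary free vertex in each round: [F] is what Dominator owns when such a
    play ends. A winning position thus yields one concrete set that reaches the goal without
    Staller's vertices. *)
Lemma mb_final k D S : [disjoint D & S] -> mb k D S ->
  exists F : {set V}, [/\ goal F, [disjoint F & S] & #|F| <= #|D| + k].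
Proof.
elim: k D S => [|k IHk] D S dDS w.
  by exists D; rewrite addn0; move: w; rewrite /= orbF.
have [g|ng] := boolP (goal D); first by exists D; split=> //; apply: leq_addr.
have [_ [<-] [/set0Pn[x xU] h]] := mbP w ng.
have [y yU /IHk[|F [gF dF cF]]] := h x xU; first exact: disjoint_move.
exists F; split=> //.
  by apply: disjointWr dF; rewrite subsetUr.
by apply: leq_trans cF _; rewrite addnS -addSn leq_add2r cardsU1; case: (_ \notin _).
Qed.

End Goals.

Lemma eq_mb (V : finType) (g1 g2 : pred {set V}) :
  g1 =1 g2 -> forall k D S, mb g1 k D S = mb g2 k D S.
Proof.
move=> eg; elim=> [|k IHk] D S /=; rewrite eg //; congr (_ || (_ && _)).
apply: eq_forallb => x; congr (_ ==> _); apply: eq_existsb => y.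
by rewrite IHk.
Qed.

Lemma eq_wc (V : finType) (g1 g2 : pred {set V}) :
  g1 =1 g2 -> forall k D S, wc g1 k D S = wc g2 k D S.
Proof.
move=> eg; elim=> [|k IHk] D S /=; rewrite eg //; congr (_ || _).
by apply: eq_existsb => x; congr (_ && _); apply: eq_existsb => y; rewrite !IHk.
Qed.

Lemma mb_winsE (G : sgraph) k (D S : {set G}) :
  mb_wins k D S = mb (@dominating G) k D S.
Proof. by []. Qed.

Lemma wc_winsE (G : sgraph) k (D S : {set G}) :
  wc_wins k D S = wc (@dominating G) k D S.
Proof. by []. Qed.

(** * Adding a pair of vertices *)

Section AddPair.
Variables (V : finType) (goal touch : pred {set V}).
Notation V' := (V + bool)%type.
Implicit Types (D S : {set V'}) (x y : V) (b : bool).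

Definition old D : {set V} := inl @^-1: D.

Definition pair_goal D : bool :=
  goal (old D) && [|| touch (old D), inr true \in D | inr false \in D].

Lemma in_old x D : (x \in old D) = (inl x \in D).
Proof. by rewrite inE. Qed.

Lemma old_inl x D : old (inl x |: D) = x |: old D.
Proof. by apply/setP=> z; rewrite !inE. Qed.

Lemma old_inr b D : old (inr b |: D) = old D.
Proof. by apply/setP=> z; rewrite !inE. Qed.

Lemma old_set0 : old set0 = set0.
Proof. by apply/setP=> z; rewrite !inE. Qed.

Lemma inl_free x D S : (inl x \in ~: (D :|: S)) = (x \in ~: (old D :|: old S)).
Proof. by rewrite !inE. Qed.

Definition untouched D S := forall b, inr b \in ~: (D :|: S).
Definition split D S := exists2 b, inr b \in D & inr (~~ b) \in S.

Lemma untouched_inl x y D S :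
  untouched D S -> untouched (inl y |: D) (inl x |: S).
Proof. by move=> h b; have := h b; rewrite !inE. Qed.

Lemma split_sub D S D1 S1 : D \subset D1 -> S \subset S1 -> split D S -> split D1 S1.
Proof. by move=> /subsetP hD /subsetP hS [b /hD ? /hS ?]; exists b. Qed.

Lemma split_inl x y D S : split D S -> split (inl y |: D) (inl x |: S).
Proof. by apply: split_sub; apply: subsetUr. Qed.

Lemma split_goal D S : split D S -> pair_goal D = goal (old D).
Proof. by case=> -[] bD _; rewrite /pair_goal bD /= ?orbT andbT. Qed.

Lemma split_free D S b : split D S -> inr b \notin ~: (D :|: S).
Proof.
by case=> c cD cS; rewrite !inE negbK; case: b c cD cS => [] [] /= cD cS; rewrite ?cD ?cS ?orbT.
Qed.

(** With one vertex of the pair on each side, the condition of the pair is met and nothing in it is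
    left to claim, so only the game on the old board remains. *)
Lemma mb_split k D S : split D S ->
  mb pair_goal k D S = mb goal k (old D) (old S).
Proof.
elim: k D S => [|k IHk] D S sp; first by rewrite /= (split_goal sp).
have spU := split_free _ sp.
apply/idP/idP => w.
  have [/mb_goal //|ng] := boolP (goal (old D)).
  have [|_ [<-] [/set0Pn ne h]] := mbP w; first by rewrite (split_goal sp).
  apply: mb_step => [|x].
    case: ne => -[x|b] xU; last by rewrite (negbTE (spU b)) in xU.
    by apply/set0Pn; exists x; rewrite -inl_free.
  rewrite -inl_free => /h[[y|b] yU wy]; last first.
    by have := split_free b (split_sub (subxx D) (subsetUr [set inl x] S) sp); rewrite yU.
  exists y; first by rewrite -old_inl -inl_free.
  by rewrite -!old_inl -IHk // ; apply: split_inl.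
have [g|ng] := boolP (goal (old D)); first by apply: mb_goal; rewrite (split_goal sp).
have [_ [<-] [/set0Pn[z zU] h]] := mbP w ng.
apply: mb_step => [|[x|b]]; last by rewrite (negbTE (spU b)).
  by apply/set0Pn; exists (inl z); rewrite inl_free.
rewrite inl_free => /h[y yU wy]; exists (inl y); first by rewrite inl_free old_inl.
by rewrite IHk ?old_inl //; apply: split_inl.
Qed.

Lemma wc_split k D S : split D S ->
  wc pair_goal k D S = wc goal k (old D) (old S).
Proof.
elim: k D S => [|k IHk] D S sp; first by rewrite /= (split_goal sp).
have spU := split_free _ sp.
apply/idP/idP => w.
  have [/wc_goal //|ng] := boolP (goal (old D)).
  have [|_ [<-] [x [y [xU yU nxy w1 w2]]]] := wcP w; first by rewrite (split_goal sp).
  case: x xU nxy w1 w2 => [x|b] xU; last by rewrite (negbTE (spU b)) in xU.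
  case: y yU => [y|b] yU nxy w1 w2; last by rewrite (negbTE (spU b)) in yU.
  move: xU yU; rewrite !inl_free => xU yU; apply: (wc_step xU yU) => //;
  by rewrite -!old_inl -IHk //; apply: split_inl.
have [g|ng] := boolP (goal (old D)); first by apply: wc_goal; rewrite (split_goal sp).
have [_ [<-] [x [y [xU yU nxy w1 w2]]]] := wcP w ng.
rewrite -!inl_free in xU yU; apply: (wc_step xU yU) => //;
by rewrite IHk ?old_inl //; apply: split_inl.
Qed.

Lemma pair_goalW D b : goal (old D) -> inr b \in D -> pair_goal D.
Proof. by rewrite /pair_goal => -> /=; case: b => -> /=; rewrite ?orbT. Qed.

(** Dominator follows the old strategy and answers a move in the pair by the other vertex of the
    pair. If the pair is still untouched when the old goal is reached, one extra round gives her one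
    of its vertices. *)
Lemma mb_pair_up k D S : untouched D S ->
  mb goal k (old D) (old S) -> mb pair_goal k.+1 D S.
Proof.
have ne D1 S1 : untouched D1 S1 -> ~: (D1 :|: S1) != set0.
  by move=> h; apply/set0Pn; exists (inr true).
have won j D1 S1 : untouched D1 S1 -> goal (old D1) -> mb pair_goal j.+1 D1 S1.
  move=> un g; apply: (@mb_leq _ _ 1) => //; apply: mb_step => [|x xU]; first exact: ne.
  have [b bx] : exists b, inr b != x.
    by case: x xU => [x|b] _; [exists true|exists (~~ b); case: b].
  exists (inr b); first by have := un b; rewrite !inE (negbTE bx).
  by apply/mb_goal/(@pair_goalW _ b); rewrite ?old_inr // !inE eqxx.
elim: k D S => [|k IHk] D S un w.
  by apply: won => //; move: w; rewrite /= orbF.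
have [/(won k.+1 _ _ un)//|ng] := boolP (goal (old D)).
have [_ [<-] [_ h]] := mbP w ng.
apply: mb_step => [|[x|b] xU]; first exact: ne.
  move: xU; rewrite inl_free => /h[y yU wy]; exists (inl y).
    by rewrite inl_free old_inl.
  by apply: IHk; rewrite ?old_inl //; apply: untouched_inl.
exists (inr (~~ b)); first by have := un (~~ b); rewrite !inE; case: (b).
by rewrite mb_split ?old_inr //; exists (~~ b); rewrite ?negbK !inE eqxx.
Qed.

(** Dominator plays the old strategy first and then offers the pair, of which she receives one
    vertex whatever Staller keeps. *)
Lemma wc_pair_up k D S : untouched D S ->
  wc goal k (old D) (old S) -> wc pair_goal k.+1 D S.
Proof.
have won j D1 S1 : untouched D1 S1 -> goal (old D1) -> wc pair_goal j.+1 D1 S1.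
  move=> un g; apply: (wc_step (un true) (un false)) => //; apply: wc_goal.
    by apply: (@pair_goalW _ false); rewrite ?old_inr // !inE eqxx.
  by apply: (@pair_goalW _ true); rewrite ?old_inr // !inE eqxx.
elim: k D S => [|k IHk] D S un w.
  by apply: won => //; move: w; rewrite /= orbF.
have [/(won k.+1 _ _ un)//|ng] := boolP (goal (old D)).
have [_ [<-] [x [y [xU yU nxy w1 w2]]]] := wcP w ng.
rewrite -!inl_free in xU yU; apply: (wc_step xU yU) => //;
by apply: IHk; rewrite ?old_inl //; apply: untouched_inl.
Qed.

(* When her strategy plays in the pair, Dominator plays an arbitrary old vertex
   instead, so she may own a set [D0] larger than [old D]. *)
Lemma mb_pair_restrict k D S (D0 : {set V}) :
  (forall A B : {set V}, A \subset B -> goal A -> goal B) ->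
  [disjoint D & S] -> old D \subset D0 ->
  mb pair_goal k D S -> mb goal k D0 (old S).
Proof.
move=> mono; elim: k D S D0 => [|k IHk] D S D0 dDS sub w.
  by move: w; rewrite /= !orbF => /andP[g _]; apply: mono g.
have [/mb_goal //|ng0] := boolP (goal D0).
have ng : ~~ pair_goal D by apply: contra ng0 => /andP[g _]; apply: mono g.
(* If Dominator's old vertices and Staller's fill the old board, hers contain the old part of every
   set avoiding his, in particular of the final set given by [mb_final]. *)
have full (S1 : {set V'}) (D1 : {set V}) : ~: (D1 :|: old S1) == set0 ->
    (exists k' D', [disjoint D' & S1] /\ mb pair_goal k' D' S1) -> goal D1.
  move=> /eqP e0 [k' [D' [dS1 /(mb_final dS1)[F [/andP[gF _] dF _]]]]].
  apply: mono gF; apply/subsetP=> z; rewrite in_old => zF.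
  have := in_set0 z; rewrite -e0 !inE => /negbFE/orP[//|zS].
  by rewrite (disjointFr dF zF) in zS.
apply: mb_step => [|x].
  apply: contra ng0 => e0; apply: full e0 _; by exists k.+1, D.
rewrite in_setC in_setU negb_or => /andP[xD0 xS].
have xU : inl x \in ~: (D :|: S).
  by rewrite inl_free in_setC in_setU negb_or xS andbT; apply: contra xD0; apply: (subsetP sub).
have [_ [<-] [_ h]] := mbP w ng.
have [y yU wy] := h _ xU.
have dDS1 := disjoint_move dDS xU yU.
pose good y0 := (y0 \in ~: (D0 :|: (x |: old S))) && (old (y |: D) \subset y0 |: D0).
have [[y0 /andP[y0U ysub]]|no] : (exists y0, good y0) \/ (forall y0, ~~ good y0).
- by have [/existsP|/existsPn] := boolP [exists y0, good y0]; [left|right].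
- by exists y0 => //; rewrite -old_inl; apply: IHk wy.
(* A reply [y] in the pair, or one already in [D0], may be replaced by any free old vertex, and any
   other [y] is itself a good reply. So when no reply is good, no old vertex is free. *)
have D0full : ~: (D0 :|: old (inl x |: S)) == set0.
  rewrite old_inl; apply: contraT => /set0Pn[z zU].
  move: no; rewrite /good {good} => no.
  case: y yU no {dDS1 wy} => [y|b] yU no; last first.
    have := no z; rewrite zU /= old_inr; case/negP.
    exact: subset_trans sub (subsetUr _ _).
  have [yD0|yD0] := boolP (y \in D0).
    have := no z; rewrite zU /= old_inl subUset sub1set in_setU yD0 orbT /=.
    by case/negP; exact: subset_trans sub (subsetUr _ _).
  have := no y; rewrite old_inl setUS // andbT => /negP[].
  by move: yU; rewrite !inE !negb_or => /and3P[_ ??]; apply/and3P.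
case/negP: ng0; apply: full D0full _.
by exists k, (y |: D).
Qed.

(** When an offer contains a vertex of the pair, follow the branch in which Dominator receives that
    vertex: her old vertices do not change, so the round is dropped from the old game. Staller may
    have gained an old vertex there, whence the smaller set [S0]. *)
Lemma wc_pair_restrict k D S (S0 : {set V}) : S0 \subset old S ->
  wc pair_goal k D S -> wc goal k (old D) S0.
Proof.
elim: k D S S0 => [|k IHk] D S S0 sub w.
  by move: w; rewrite /= !orbF => /andP[].
have [/wc_goal //|ng0] := boolP (goal (old D)).
have [|_ [<-] [x [y [xU yU nxy w1 w2]]]] := wcP w.
  by rewrite negb_and ng0.
have sub' z : S0 \subset old (z |: S).
  by apply: subset_trans sub _; apply: preimsetS; apply: subsetUr.
have freeS z : inl z \in ~: (D :|: S) -> z \in ~: (old D :|: S0).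
  rewrite inl_free !in_setC !in_setU !negb_or => /andP[-> /=].
  by apply: contra; apply: (subsetP sub).
case: x xU nxy w1 w2 => [x|b] xU nxy w1 w2; last first.
  by apply: (@wc_leq _ _ k) => //; rewrite -(old_inr b); apply: IHk w2.
case: y yU nxy w1 w2 => [y|b] yU nxy w1 w2; last first.
  by apply: (@wc_leq _ _ k) => //; rewrite -(old_inr b); apply: IHk w1.
by apply: (wc_step (freeS _ xU) (freeS _ yU)) => //; rewrite -old_inl;
   [apply: IHk w1|apply: IHk w2]; rewrite old_inl setUS.
Qed.

Hypothesis touch0 : touch =1 xpred0.

Lemma isolated_goal D : (forall b, inr b \notin D) -> ~~ pair_goal D.
Proof. by move=> h; rewrite /pair_goal touch0 !(negbTE (h _)) andbF. Qed.

(** Staller opens in the pair. Dominator has to take the other vertex at once, so this round brings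
    her nothing on the old board. *)
Lemma mb_isolated_pair k D S : [disjoint D & S] -> untouched D S ->
  mb pair_goal k.+1 D S -> mb goal k (old D) (old S).
Proof.
move=> dDS un w.
have nD b : inr b \notin D by have := un b; rewrite !inE negb_or => /andP[].
have nS b : inr b \notin S by have := un b; rewrite !inE negb_or => /andP[].
have [_ [<-] [_ h]] := mbP w (isolated_goal nD).
have [y yU wy] := h _ (un true).
have [ey|ny] := eqVneq y (inr false).
  move: wy; rewrite ey mb_split ?old_inr //.
  by exists false; rewrite !inE eqxx.
(* Dominator replied outside the pair: Staller takes its second vertex as well, and no set disjoint
   from his can then satisfy the pair. *)
have nD1 b : inr b \notin y |: D.
  rewrite in_setU1 negb_or nD andbT eq_sym; case: b => //.
  by apply: contraTneq yU => ->; rewrite !inE eqxx orbT.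
have [k' _ [_ h']] := mbP wy (isolated_goal nD1).
have fU : inr false \in ~: ((y |: D) :|: (inr true |: S)).
  by rewrite in_setC in_setU negb_or nD1 in_setU1 negb_or nS.
have [z zU wz] := h' _ fU.
have dd := disjoint_move (disjoint_move dDS (un true) yU) fU zU.
have [F [gF dF _]] := mb_final dd wz.
suff: ~~ pair_goal F by rewrite gF.
apply: isolated_goal => b; rewrite (disjointFl dF) //.
by case: b; rewrite !inE eqxx ?orbT.
Qed.

(* Staller keeps [inr b] and then picks [inr (~~ b)] whenever it is offered. *)
Lemma wc_isolated_lost k D S b : inr b \in S -> (forall c, inr c \notin D) ->
  ~~ wc pair_goal k D S.
Proof.
elim: k D S => [|k IHk] D S bS nD; first by rewrite /= orbF isolated_goal.
apply/negP=> w; have [_ [<-] [x [y [xU yU nxy w1 w2]]]] := wcP w (isolated_goal nD).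
have add z : inr (~~ b) != z -> z \in ~: (D :|: S) -> forall c, inr c \notin z |: D.
  move=> nz zU c; rewrite in_setU1 negb_or nD andbT.
  have [->//|] := eqVneq c (~~ b).
  move=> nc; have -> : c = b by case: (b) (c) nc => [] [].
  by apply: contraTneq zU => <-; rewrite !inE bS orbT.
have [ey|ny] := eqVneq (inr (~~ b)) y.
  have nx : inr (~~ b) != x by rewrite ey eq_sym.
  by have := IHk (x |: D) (y |: S); rewrite w2 in_setU1 bS orbT => /(_ isT (add x nx xU)).
by have := IHk (y |: D) (x |: S); rewrite w1 in_setU1 bS orbT => /(_ isT (add y ny yU)).
Qed.

(** By [wc_isolated_lost], offering a vertex of the pair together with an old one loses. Hence the
    two are offered together in some round, and deleting that round leaves a strategy on the old
    board. *)
Lemma wc_isolated_pair k D S : untouched D S ->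
  wc pair_goal k.+1 D S -> wc goal k (old D) (old S).
Proof.
move=> un w.
have nD b : inr b \notin D by have := un b; rewrite !inE negb_or => /andP[].
elim: k D S un nD w => [|k IHk] D S un nD w.
all: have [_ [<-] [x [y [xU yU nxy w1 w2]]]] := wcP w (isolated_goal nD).
all: have lost z b j : wc pair_goal j (inl z |: D) (inr b |: S) -> False
       by apply/negP; apply: (@wc_isolated_lost _ _ _ b) => [|c];
          rewrite !inE ?eqxx // nD.
all: have both b c : inr b != inr c :> V' -> forall j,
       wc pair_goal j (inr b |: D) (inr c |: S) -> wc goal j (old D) (old S)
       by move=> bc j; rewrite wc_split ?old_inr //; exists b; rewrite !inE ?eqxx //;
          case: (b) (c) bc => -[].
all: case: x xU nxy w1 w2 => [x|b] xU nxy w1 w2;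
     case: y yU nxy w1 w2 => [y|c] yU nxy w1 w2;
     try by [case: (lost _ _ _ w1)|case: (lost _ _ _ w2)].
- have /isolated_goal : forall b, inr b \notin inl y |: D.
    by move=> b; rewrite !inE nD.
  by move: w1 => /=; rewrite orbF => ->.
- exact: both w2.
- rewrite !inl_free in xU yU; apply: (wc_step xU yU) => //; rewrite -!old_inl;
  apply: IHk => // [|b]; rewrite ?inE ?nD //; exact: untouched_inl.
- exact: both w2.
Qed.

End AddPair.

(** * Cliques with gadgets *)

Section Boards.
Variable C : finType.
Implicit Types (e : {set C}) (L : seq {set C}).

(** One summand [bool] per gadget, so that each step of a recursion on [L] is an instance of adding
    a pair. *)
Fixpoint board L : finType :=
  if L is _ :: L' then (board L' + bool)%type : finType else C.

Fixpoint core L : C -> board L :=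
  if L is _ :: L' return C -> board L then fun c => inl (core L' c) else id.

(** The core itself imposes no condition here; a gadget on [setT] will take care of dominating
    it. *)
Fixpoint hits L : pred {set board L} :=
  if L is e :: L' return pred {set board L}
  then pair_goal (@hits L') (fun D => ~~ [disjoint e & core L' @^-1: D])
  else predT.

Fixpoint link L : rel (board L) :=
  if L is e :: L' return rel (board L) then
    fun x y => match x, y with
    | inl x, inl y => @link L' x y
    | inl x, inr _ => x \in core L' @: e
    | inr _, inl y => y \in core L' @: e
    | inr b, inr c => b != c
    end
  else fun x y => x != y.

Lemma link_sym L : symmetric (@link L).
Proof.
elim: L => [|e L IHL] /=; first by move=> x y; rewrite eq_sym.
by move=> [x|b] [y|c] //; rewrite eq_sym.
Qed.

Lemma link_irrefl L : irreflexive (@link L).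
Proof.
elim: L => [|e L IHL] /=; first by move=> x; rewrite eqxx.
by move=> [x|b] //; rewrite eqxx.
Qed.

Definition graph L := SGraph (@link_sym L) (@link_irrefl L).

Lemma core_inj L : injective (core L).
Proof. by elim: L => [|e L IHL] c1 c2 //= [/IHL]. Qed.

Lemma link_core L c1 c2 : link (core L c1) (core L c2) = (c1 != c2).
Proof. by elim: L. Qed.

Lemma hitsS L (A B : {set board L}) : A \subset B -> hits A -> hits B.
Proof.
elim: L A B => [|e L IHL] //= A B sub; rewrite /pair_goal.
have sub' : old A \subset old B by apply: preimsetS.
case/andP=> /(IHL _ _ sub') -> /=; case/or3P=> [h|/(subsetP sub)->|/(subsetP sub)->].
- by apply/or3P/Or31; apply: contra h; apply: disjointWr; apply: preimsetS.
- by rewrite orbT.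
- by rewrite !orbT.
Qed.

Lemma core_old e L (D : {set board (e :: L)}) :
  core L @^-1: old D = core (e :: L) @^-1: D.
Proof. by apply/setP=> c; rewrite !inE. Qed.

Lemma hits_core L (D : {set board L}) :
  (forall e, e \in L -> ~~ [disjoint e & core L @^-1: D]) -> hits D.
Proof.
elim: L D => [|e L IHL] //= D h; rewrite /pair_goal (@core_old e L D) h ?mem_head // andbT.
by apply: IHL => e1 e1L; rewrite (@core_old e L D) h // in_cons e1L orbT.
Qed.

Lemma card_old_inr (V : finType) (D : {set V + bool}) b :
  inr b \in D -> #|old D| < #|D|.
Proof.
move=> bD; rewrite -(card_imset _ (@inl_inj V bool)).
apply: leq_trans (_ : #|inr b |: inl @: old D| <= _).
  by rewrite cardsU1; case: imsetP => // -[].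
apply: subset_leq_card; apply/subsetP=> x; rewrite !inE => /orP[/eqP->//|].
by case/imsetP => y; rewrite inE => ? ->.
Qed.

Lemma card_old (V : finType) (D : {set V + bool}) : #|old D| <= #|D|.
Proof.
rewrite -(card_imset _ (@inl_inj V bool)); apply: subset_leq_card.
by apply/subsetP=> x /imsetP[y]; rewrite inE => ? ->.
Qed.

(** If [D] misses [e], it must own a new vertex in each gadget on [e], and these vertices are
    distinct. *)
Lemma hits_few L e (D : {set board L}) : hits D -> #|D| < count_mem e L ->
  ~~ [disjoint e & core L @^-1: D].
Proof.
elim: L D => [|e1 L IHL] //= D /andP[gD tD] cD.
have [//|dis] := boolP (~~ [disjoint e & core (e1 :: L) @^-1: D]).
rewrite -(@core_old e1 L D) in dis.
have nIH : count_mem e L <= #|old D|.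
  by rewrite leqNgt; apply: contra dis; apply: IHL.
have [e1e|ne] := eqVneq e1 e; last first.
  by have := leq_ltn_trans (leq_trans nIH (card_old D)) cD; rewrite (negbTE ne) ltnn.
move: tD cD; rewrite e1e (negbTE dis) eqxx /= add1n ltnS.
case/orP=> /card_old_inr lt /(leq_trans lt); by rewrite ltnNge nIH.
Qed.

Lemma hits_link L (D : {set board L}) e : e \in L -> hits D ->
  (exists2 c, c \in e & core L c \in D) \/
  (exists2 w, w \in D & forall c, c \in e -> link w (core L c)).
Proof.
elim: L D => [|e1 L IHL] //= D; rewrite in_cons.
have [->|ne] /= := eqVneq e e1; last first.
  move=> eL /andP[/(IHL _ eL)[[c ce cD]|[w wD h]] _].
    by left; exists c => //; rewrite in_old in cD.
  by right; exists (inl w) => //; rewrite in_old in wD.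
have pairD b : inr b \in D -> exists2 w, w \in D & forall c, c \in e1 -> @link (e1 :: L) w (core (e1 :: L) c).
  by move=> bD; exists (inr b) => //= c ce; apply: imset_f.
move=> _ /andP[_ /or3P[|/pairD|/pairD]]; [|by right|by right].
by case/pred0Pn => c /=; rewrite !inE => /andP[ce cD]; left; exists c.
Qed.

(** Both new vertices of a gadget have the same closed neighbourhood, namely [e] and the two of
    them, so dominating either is the condition of the gadget. Gadgets added later are joined to the
    core only and do not affect this. *)
Lemma hits_gadgets L (D : {set board L}) :
  reflect (forall v, v \notin codom (core L) ->
             (v \in D) || [exists u in D, link u v])
          (hits D).
Proof.
elim: L D => [|e L IHL] D.
  by apply: (iffP idP) => // _ v; rewrite codom_f.
have oldN v : inl v \notin codom (core (e :: L)) -> v \notin codom (core L).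
  by apply: contra => /codomP[c ->]; apply: codom_f.
have oldE v : v \notin codom (core L) ->
    [exists u in D, @link (e :: L) u (inl v)] = [exists u in old D, link u v].
  move=> vN; apply/exists_inP/exists_inP=> [[[u|b] uD uv]|[u uD uv]].
  - by exists u => //; rewrite in_old.
  - by case/imsetP: uv vN => c _ ->; rewrite codom_f.
  - by exists (inl u) => //; rewrite in_old in uD.
have newE b : (inr b \in D) || [exists u in D, @link (e :: L) u (inr b)] =
    [|| ~~ [disjoint e & core L @^-1: old D], inr true \in D | inr false \in D].
  apply/idP/idP => [/orP[bD|/exists_inP[[u|c] uD uv]]|].
  - by case: b bD => -> ; rewrite !orbT.
  - apply/or3P/Or31/pred0Pn; case/imsetP: uv uD => c ce -> cD.
    by exists c; rewrite /= ce !inE.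
  - by case: c uD {uv} => ->; rewrite !orbT.
  case/or3P=> [/pred0Pn[c /andP[ce]]|bD|bD].
  - rewrite !inE => cD; apply/orP; right; apply/exists_inP.
    by exists (inl (core L c)) => //=; apply: imset_f.
  - by case: b => //; rewrite ?bD //; apply/orP; right; apply/exists_inP; exists (inr true).
  - by case: b => //; rewrite ?bD //; apply/orP; right; apply/exists_inP; exists (inr false).
rewrite /= /pair_goal; apply: (iffP andP) => [[/IHL h t]|h].
  case=> [v /oldN vN|b _]; last by rewrite newE.
  by have := h v vN; rewrite in_old oldE.
split; last by rewrite -(newE true); apply: h; apply/codomP => -[].
apply/IHL => v vN; rewrite in_old -oldE //; apply: h.
by apply: contra vN => /codomP[c [->]]; apply: codom_f.
Qed.

(** The gadget on [setT] puts into [D] either a core vertex, adjacent to the rest of the clique, or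
    a new vertex joined to the whole core. In both cases the core is dominated. *)
Lemma dominating_hits L (D : {set board L}) : setT \in L ->
  @dominating (graph L) D = hits D.
Proof.
move=> TL; apply/idP/idP => [/forallP dom|h].
  by apply/hits_gadgets => v _; apply: dom.
apply/forallP => v; have [/codomP[c ->]|vN] := boolP (v \in codom (core L)); last first.
  by have /hits_gadgets := h; apply.
case: (hits_link TL h) => [[c1 _ c1D]|[w wD hw]].
  have [<-|ne] := eqVneq c1 c; first by rewrite c1D.
  by apply/orP; right; apply/exists_inP; exists (core L c1); rewrite //= link_core.
by apply/orP; right; apply/exists_inP; exists w => //=; apply: hw; rewrite inE.
Qed.

Lemma untouched0 (V : finType) : @untouched V set0 set0.
Proof. by move=> b; rewrite !inE. Qed.

Lemma mb_hits_finite L : exists k, mb (@hits L) k set0 set0.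
Proof.
elim: L => [|e L [k w]]; first by exists 0.
by exists k.+1; apply: mb_pair_up; rewrite ?old_set0 //; apply: untouched0.
Qed.

Lemma wc_hits_finite L : exists k, wc (@hits L) k set0 set0.
Proof.
elim: L => [|e L [k w]]; first by exists 0.
by exists k.+1; apply: wc_pair_up; rewrite ?old_set0 //; apply: untouched0.
Qed.

Definition mb_rounds L := ex_minn (mb_hits_finite L).
Definition wc_rounds L := ex_minn (wc_hits_finite L).

Lemma mb_rounds_leq L k : (mb_rounds L <= k) = mb (@hits L) k set0 set0.
Proof.
rewrite /mb_rounds; case: ex_minnP => m w min.
by apply/idP/idP => [mk|/min//]; apply: mb_leq w.
Qed.

Lemma wc_rounds_leq L k : (wc_rounds L <= k) = wc (@hits L) k set0 set0.
Proof.
rewrite /wc_rounds; case: ex_minnP => m w min.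
by apply/idP/idP => [mk|/min//]; apply: wc_leq w.
Qed.

Lemma mb_rounds_up e L : mb_rounds (e :: L) <= (mb_rounds L).+1.
Proof.
rewrite mb_rounds_leq; apply: mb_pair_up; first exact: untouched0.
by rewrite old_set0 -mb_rounds_leq.
Qed.

Lemma wc_rounds_up e L : wc_rounds (e :: L) <= (wc_rounds L).+1.
Proof.
rewrite wc_rounds_leq; apply: wc_pair_up; first exact: untouched0.
by rewrite old_set0 -wc_rounds_leq.
Qed.

Lemma disjoint00 (V : finType) : [disjoint (set0 : {set V}) & (set0 : {set V})].
Proof. by rewrite -setI_eq0 set0I. Qed.

Lemma mb_rounds_win L : mb (@hits L) (mb_rounds L) set0 set0.
Proof. by rewrite -mb_rounds_leq. Qed.

Lemma wc_rounds_win L : wc (@hits L) (wc_rounds L) set0 set0.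
Proof. by rewrite -wc_rounds_leq. Qed.

Lemma mb_rounds_mono e L : mb_rounds L <= mb_rounds (e :: L).
Proof.
rewrite mb_rounds_leq -[X in mb _ _ _ X](old_set0 (board L)).
apply: (mb_pair_restrict _ _ _ (mb_rounds_win (e :: L))).
- exact: hitsS.
- exact: disjoint00.
- by rewrite old_set0.
Qed.

Lemma wc_rounds_mono e L : wc_rounds L <= wc_rounds (e :: L).
Proof.
rewrite wc_rounds_leq -[X in wc _ _ X _](old_set0 (board L)).
exact: (wc_pair_restrict (sub0set _) (wc_rounds_win (e :: L))).
Qed.

Lemma touch_set0 (V : finType) (P : {set V} -> {set C}) :
  (fun D => ~~ [disjoint set0 & P D]) =1 xpred0.
Proof. by move=> D; rewrite /= -setI_eq0 set0I eqxx. Qed.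

Lemma hits_isolated0 L : ~~ @hits (set0 :: L) set0.
Proof. by rewrite /= /pair_goal (touch_set0 (fun D => core L @^-1: D)) !inE andbF. Qed.

Lemma mb_rounds_isolated L : mb_rounds (set0 :: L) = (mb_rounds L).+1.
Proof.
apply/eqP; rewrite eqn_leq mb_rounds_up /=.
have [m ek _] := mbP (mb_rounds_win (set0 :: L)) (hits_isolated0 L).
have := mb_rounds_win (set0 :: L); rewrite ek => w.
rewrite ltnS mb_rounds_leq -(old_set0 (board L)).
apply: mb_isolated_pair w; first exact: touch_set0.
- exact: disjoint00.
- exact: untouched0.
Qed.

Lemma wc_rounds_isolated L : wc_rounds (set0 :: L) = (wc_rounds L).+1.
Proof.
apply/eqP; rewrite eqn_leq wc_rounds_up /=.
have [m ek _] := wcP (wc_rounds_win (set0 :: L)) (hits_isolated0 L).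
have := wc_rounds_win (set0 :: L); rewrite ek => w.
rewrite ltnS wc_rounds_leq -(old_set0 (board L)).
apply: wc_isolated_pair w; first exact: touch_set0.
exact: untouched0.
Qed.

End Boards.

(** * Games on the core *)

Section Core.
Variables (n : nat) (E : seq (seq nat)).
Implicit Types d s : seq nat.

Definition free d s := [seq x <- iota 0 n | (x \notin d) && (x \notin s)].

Definition hit_all d := all (fun e => has (fun x => x \in d) e) E.

(* Games on the vertices 0, ..., n-1 of the core only, with positions as lists.
   Moves outside the core appear as passes: by Staller in [mb_core], by
   Dominator in [mb_resists]. In [wc_resists], a core vertex offered together
   with a vertex outside the core is kept by Staller, and Dominator gets
   nothing. *)
Fixpoint mb_core k d s : bool :=
  hit_all d ||
  (if k is k'.+1 then
     has (fun y => mb_core k' (y :: d) s) (free d s) &&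
     all (fun x => has (fun y => mb_core k' (y :: d) (x :: s)) (free d (x :: s)))
       (free d s)
   else false).

Fixpoint wc_core k d s : bool :=
  hit_all d ||
  (if k is k'.+1 then
     has (fun x => has (fun y =>
       [&& x != y, wc_core k' (y :: d) (x :: s) & wc_core k' (x :: d) (y :: s)])
       (free d s)) (free d s)
   else false).

Fixpoint mb_resists j d s : bool :=
  ~~ hit_all d &&
  (if j is j'.+1 then
     has (fun e => all (fun x => x \in s) e) E ||
     has (fun x => mb_resists j' d (x :: s) &&
         all (fun y => mb_resists j' (y :: d) (x :: s)) (free d (x :: s)))
       (free d s)
   else false).

Fixpoint wc_resists j d s : bool :=
  ~~ hit_all d &&
  (if j is j'.+1 then
     all (fun x => wc_resists j' d (x :: s) &&
         all (fun y => [|| x == y, wc_resists j' (y :: d) (x :: s)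
                                 | wc_resists j' (x :: d) (y :: s)]) (free d s))
       (free d s)
   else false).

Variables (V : finType) (emb : 'I_n -> V) (goal : pred {set V}).
Hypothesis embinj : injective emb.
Implicit Types (D S : {set V}) (c : 'I_n).

Definition shows d D := forall c, (emb c \in D) = (val c \in d).

Lemma shows0 : shows [::] set0.
Proof. by move=> c; rewrite inE. Qed.

Lemma shows_core d D c : shows d D -> shows (val c :: d) (emb c |: D).
Proof.
by move=> h c1; rewrite in_setU1 in_cons h (inj_eq embinj) (inj_eq val_inj).
Qed.

Lemma shows_other d D x : x \notin codom emb -> shows d D -> shows d (x |: D).
Proof.
move=> xN h c; rewrite in_setU1 h; case: eqP => // e.
by rewrite -e codom_f in xN.
Qed.

Lemma free_core d s D S c : shows d D -> shows s S ->
  (emb c \in ~: (D :|: S)) = (val c \in free d s).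
Proof.
by move=> hd hs; rewrite mem_filter mem_iota /= ltn_ord andbT !inE negb_or hd hs.
Qed.

Lemma freeP d s D S y : shows d D -> shows s S -> y \in free d s ->
  exists2 c, val c = y & emb c \in ~: (D :|: S).
Proof.
move=> hd hs yf; have yn : y < n by move: yf; rewrite mem_filter mem_iota => /andP[].
by exists (Ordinal yn); rewrite ?(free_core _ hd hs).
Qed.

Section Upper.
Hypothesis hit_goal : forall d D, shows d D -> hit_all d -> goal D.

Lemma mb_core_sound k d s D S : shows d D -> shows s S ->
  mb_core k d s -> mb goal k D S.
Proof.
elim: k d s D S => [|k IHk] d s D S hd hs.
  by rewrite /= !orbF; apply: hit_goal.
rewrite /=; case/orP => [/(hit_goal hd)->//|/andP[/hasP[y yf wy] /allP h]].
have [c cy cU] := freeP hd hs yf.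
apply: mb_step => [|x xU]; first by apply/set0Pn; exists (emb c).
(* A move of Staller outside the core is a pass, answered by the vertex [y] that [mb_core] reserves
   for this case. *)
have [/codomP[b xb]|xN] := boolP (x \in codom emb); last first.
  exists (emb c).
    move: cU; rewrite !inE !negb_or => /andP[-> ->]; rewrite andbT /=.
    by apply: contraNneq xN => <-; apply: codom_f.
  by apply: IHk wy; rewrite -?cy; [apply: shows_core|apply: shows_other].
rewrite xb; rewrite xb (free_core _ hd hs) in xU.
have hs1 := shows_core b hs.
have /hasP[z /(freeP hd hs1)[a az aU] wz] := h _ xU.
by exists (emb a) => //; apply: IHk wz; rewrite -?az //; apply: shows_core.
Qed.

Lemma wc_core_sound k d s D S : shows d D -> shows s S ->
  wc_core k d s -> wc goal k D S.
Proof.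
elim: k d s D S => [|k IHk] d s D S hd hs.
  by rewrite /= !orbF; apply: hit_goal.
rewrite /=; case/orP => [/(hit_goal hd)->//|/hasP[x xf /hasP[y yf /and3P[nxy w1 w2]]]].
have [a ax aU] := freeP hd hs xf; have [b by_ bU] := freeP hd hs yf.
move: nxy w1 w2; rewrite -ax -by_ => nxy w1 w2; apply: (wc_step aU bU).
- by rewrite (inj_eq embinj) -(inj_eq val_inj).
- by apply: IHk w1; apply: shows_core.
- by apply: IHk w2; apply: shows_core.
Qed.

End Upper.

Section Lower.
Variable m : nat.
Hypothesis goal_hit :
  forall d D, shows d D -> goal D -> #|D| <= m -> hit_all d.

(** The invariant [#|D| + k <= m] keeps Dominator's set small enough for [goal_hit] until the last
    round. An offer entirely outside the core leaves the lists and [j] as they are, hence the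
    induction on [k]. *)
Lemma wc_resists_sound j k d s D S : shows d D -> shows s S ->
  #|D| + k <= m -> wc_resists j d s -> ~~ wc goal k D S.
Proof.
elim: k j d s D S => [|k IHk] j d s D S hd hs cD res; apply/negP=> w.
all: have nh : ~~ hit_all d by case: j res => [|j] /= /andP[].
all: have ng : ~~ goal D by apply: contra nh => g; apply: goal_hit hd g _;
       apply: leq_trans cD; apply: leq_addr.
  by move: w; rewrite /= orbF (negbTE ng).
have [_ [<-] [x [y [xU yU nxy w1 w2]]]] := wcP w ng.
have cU z : #|z |: D| + k <= m.
  apply: leq_trans cD; rewrite addnS -addSn leq_add2r cardsU1.
  by case: (_ \notin _).
have next j' d' s' u v : u \in ~: (D :|: S) -> wc goal k (v |: D) (u |: S) ->
    shows d' (v |: D) -> shows s' (u |: S) -> ~~ wc_resists j' d' s'.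
  move=> _ wuv hd' hs'; apply/negP=> r.
  by have := IHk _ _ _ _ _ hd' hs' (cU v) r; rewrite wuv.
case: j res => [|j] /=; first by rewrite andbF.
case/andP => _ /allP h.
have single a u v : emb a \in ~: (D :|: S) -> v \notin codom emb ->
    wc goal k (v |: D) (emb a |: S) -> u = val a -> False.
  move=> aU vN wv _.
  have := aU; rewrite (free_core _ hd hs) => /h/andP[r _].
  have := next j d (val a :: s) _ _ aU wv (shows_other vN hd) (shows_core a hs).
  by rewrite r.
have [/codomP[a xa]|xN] := boolP (x \in codom emb); last first.
  have [/codomP[b yb]|yN] := boolP (y \in codom emb).
    by rewrite yb in yU w2; apply: single yU xN w2 erefl.
  have := next j.+1 d s _ _ xU w1 (shows_other yN hd) (shows_other xN hs).
  by rewrite /= nh; case/negP; apply/allP.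
have [/codomP[b yb]|yN] := boolP (y \in codom emb); last first.
  by rewrite xa in xU w1; apply: single xU yN w1 erefl.
rewrite xa yb in xU yU nxy w1 w2.
have := xU; rewrite (free_core _ hd hs) => /h/andP[_ /allP h2].
have := yU; rewrite (free_core _ hd hs) => /h2.
rewrite (inj_eq val_inj) -(inj_eq embinj) (negbTE nxy) /=.
rewrite (negbTE (next j _ _ _ _ xU w1 (shows_core b hd) (shows_core a hs))).
by rewrite (negbTE (next j _ _ _ _ yU w2 (shows_core a hd) (shows_core b hs))).
Qed.

Lemma mb_resists_sound j k d s D S : shows d D -> shows s S ->
  [disjoint D & S] -> #|D| + k <= m -> mb_resists j d s -> ~~ mb goal k D S.
Proof.
elim: j k d s D S => [|j IHj] k d s D S hd hs dDS cD /=; first by rewrite andbF.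
case/andP => nh res; apply/negP=> w.
case/orP: res => [/hasP[e eE /allP es]|/hasP[x xf /andP[pass /allP h]]].
  (* Staller owns the edge [e], so Dominator's final set avoids it; but that set has at most [m]
     elements and must meet [e]. *)
  have [F [gF dF cF]] := mb_final dDS w.
  have hF : shows [seq val c | c <- enum 'I_n & emb c \in F] F.
    by move=> c; rewrite (mem_map val_inj) mem_filter mem_enum andbT.
  have /allP/(_ e eE)/hasP[y ye /mapP[c]] := goal_hit hF gF (leq_trans cF cD).
  rewrite mem_filter => /andP[cF' _] yc.
  by have := disjointFr dF cF'; rewrite hs -yc es.
have ng : ~~ goal D.
  by apply: contra nh => g; apply: goal_hit hd g _; apply: leq_trans cD; apply: leq_addr.
have [a ax aU] := freeP hd hs xf.
have [k' ek [_ hw]] := mbP w ng.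
have [y yU wy] := hw _ aU.
have dis := disjoint_move dDS aU yU.
have cU : #|y |: D| + k' <= m.
  apply: leq_trans cD; rewrite ek addnS -addSn leq_add2r cardsU1.
  by case: (_ \notin _).
have hs1 := shows_core a hs; rewrite ax in hs1.
suff /negP[] : ~~ mb goal k' (y |: D) (emb a |: S) by [].
have [/codomP[b yb]|yN] := boolP (y \in codom emb).
  rewrite yb in yU dis cU; rewrite yb; apply: (IHj _ _ _ _ _ (shows_core b hd) hs1 dis cU).
  by apply: h; rewrite -(free_core _ hd hs1).
exact: IHj (shows_other yN hd) hs1 dis cU pass.
Qed.

End Lower.
End Core.

(** * Gadgets on the edges of a hypergraph *)

Definition edge n (e : seq nat) : {set 'I_n} := [set c | val c \in e].

Definition edges n (E : seq (seq nat)) : seq {set 'I_n} := map (edge n) E.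

Section Families.
Variables (n : nat) (E : seq (seq nat)).
Hypothesis E_bounded : all (all (fun x => x < n)) E.
Hypothesis E_neq0 : 0 < size E.
Implicit Types (K : seq {set 'I_n}) (d : seq nat).

Lemma hit_all_hits K d (D : {set board (rcons K setT)}) :
  {subset K <= edges n E} -> shows (core _) d D -> hit_all E d -> hits D.
Proof.
move=> KE hd /allP hE; apply: hits_core.
have meet e0 : e0 \in E ->
    exists2 c : 'I_n, val c \in e0 & c \in core (rcons K setT) @^-1: D.
  move=> eE; have /hasP[x xe xd] := hE _ eE.
  have xn : x < n by have /allP/(_ _ eE)/allP/(_ _ xe) := E_bounded.
  by exists (Ordinal xn); rewrite // inE hd.
move=> e; rewrite mem_rcons in_cons => /orP[/eqP->|/KE/mapP[e0 /meet[c ce cD] ->]].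
  (* For the gadget on [setT] any core vertex will do; one is found in the first edge of [E]. *)
  have [//|c _ cD] := meet (nth [::] E 0); first exact: mem_nth.
  by apply/pred0Pn; exists c; rewrite /= in_setT.
by apply/pred0Pn; exists c; rewrite /= inE ce.
Qed.

Definition many m : seq {set 'I_n} := flatten (nseq m (edges n E)).

Lemma many_sub m : {subset many m <= edges n E}.
Proof. by move=> e /flattenP[s]; rewrite mem_nseq => /andP[_ /eqP->]. Qed.

Lemma count_many m e : e \in edges n E -> m <= count_mem e (many m).
Proof.
move=> eE; rewrite count_flatten map_nseq sumn_nseq; apply: leq_pmull.
by rewrite -has_count has_pred1.
Qed.

(** With [m.+1] gadgets on each edge, a set of at most [m] vertices cannot afford to miss an
    edge. *)
Lemma hits_many m d (D : {set board (rcons (many m.+1) setT)}) :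
  shows (core _) d D -> hits D -> #|D| <= m -> hit_all E d.
Proof.
move=> hd hD cD; apply/allP => e eE.
have : ~~ [disjoint edge n e & core _ @^-1: D].
  apply: hits_few => //; apply: leq_ltn_trans cD _.
  have mL : m < count_mem (edge n e) (many m.+1) by apply/count_many/map_f.
  by apply: leq_trans mL _; rewrite -(cats1 (many m.+1)) (count_cat _ (many m.+1)) leq_addr.
case/pred0Pn => c /=; rewrite !inE hd => /andP[ce cd].
by apply/hasP; exists (val c).
Qed.

(** The bound is uniform in [K]: one core vertex in an edge settles all gadgets on that edge,
    however often it is repeated. *)
Lemma mb_rounds_core k K : {subset K <= edges n E} ->
  mb_core n E k [::] [::] -> mb_rounds (rcons K setT) <= k.
Proof.
move=> KE w; rewrite mb_rounds_leq.
refine (mb_core_sound (@core_inj _ _) _ (shows0 _) (shows0 _) w) => d D.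
exact: hit_all_hits.
Qed.

Lemma wc_rounds_core k K : {subset K <= edges n E} ->
  wc_core n E k [::] [::] -> wc_rounds (rcons K setT) <= k.
Proof.
move=> KE w; rewrite wc_rounds_leq.
refine (wc_core_sound (@core_inj _ _) _ (shows0 _) (shows0 _) w) => d D.
exact: hit_all_hits.
Qed.

Lemma mb_rounds_many j m : mb_resists n E j [::] [::] ->
  m < mb_rounds (rcons (many m.+1) setT).
Proof.
move=> res; rewrite ltnNge mb_rounds_leq.
refine (mb_resists_sound (@core_inj _ _) (@hits_many m) (shows0 _) (shows0 _)
          (disjoint00 _) _ res).
by rewrite cards0.
Qed.

Lemma wc_rounds_many j m : wc_resists n E j [::] [::] ->
  m < wc_rounds (rcons (many m.+1) setT).
Proof.
move=> res; rewrite ltnNge wc_rounds_leq.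
refine (wc_resists_sound (@core_inj _ _) (@hits_many m) (shows0 _) (shows0 _)
          _ res).
by rewrite cards0.
Qed.

End Families.

(** * Reaching prescribed values of the two parameters *)

Lemma hits_setT0 (C : finType) : ~~ @hits C [:: setT] set0.
Proof. by rewrite /= /pair_goal old_set0 preimset0 -setI_eq0 setI0 eqxx !inE. Qed.

Lemma mb_rounds_setT (C : finType) : mb_rounds [:: [set: C]] = 1.
Proof.
apply/eqP; rewrite eqn_leq; apply/andP; split.
  by apply: leq_trans (mb_rounds_up _ _) _; rewrite ltnS mb_rounds_leq.
by have [k -> _] := mbP (mb_rounds_win [:: setT]) (hits_setT0 C).
Qed.

Lemma wc_rounds_setT (C : finType) : wc_rounds [:: [set: C]] = 1.
Proof.
apply/eqP; rewrite eqn_leq; apply/andP; split.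
  by apply: leq_trans (wc_rounds_up _ _) _; rewrite ltnS wc_rounds_leq.
by have [k -> _] := wcP (wc_rounds_win [:: setT]) (hits_setT0 C).
Qed.

(** A discrete intermediate value argument: adding one element raises [f - g] by at most 1, as [f]
    grows by at most 1 and [g] does not decrease. The first list, built from the right, on which the
    difference reaches [d] therefore attains it exactly. *)
Lemma intermediate (T : eqType) (f g : seq T -> nat) (d : nat) (K : seq T) z :
  (forall e L, f (e :: L) <= (f L).+1) -> (forall e L, g L <= g (e :: L)) ->
  f [:: z] <= g [:: z] + d -> g (rcons K z) + d <= f (rcons K z) ->
  exists2 K', {subset K' <= K} & f (rcons K' z) = g (rcons K' z) + d.
Proof.
move=> f_up g_mono base; elim: K => [|e K IHK] /= top.
  by exists [::] => //; apply/eqP; rewrite eqn_leq base.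
have [/IHK[K' sub eq]|lt] := leqP (g (rcons K z) + d) (f (rcons K z)).
  by exists K' => // x /sub xK; rewrite in_cons xK orbT.
exists (e :: K) => //=; apply/eqP; rewrite eqn_leq top andbT.
apply: leq_trans (f_up _ _) (leq_trans lt _).
by rewrite leq_add2r.
Qed.

Lemma rounds_isolated (C : finType) (L : seq {set C}) r :
  mb_rounds (nseq r set0 ++ L) = r + mb_rounds L /\
  wc_rounds (nseq r set0 ++ L) = r + wc_rounds L.
Proof.
elim: r => [|r [IHm IHw]] //=.
by rewrite mb_rounds_isolated wc_rounds_isolated IHm IHw !addSn.
Qed.

Lemma graph_rounds (C : finType) (L : seq {set C}) : setT \in L ->
  gammaMB' (graph L) = Some (mb_rounds L) /\
  gammaWC (graph L) = Some (wc_rounds L).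
Proof.
move=> TL; have dom D : @dominating (graph L) D = hits D by apply: dominating_hits.
split; [apply/gammaMB'P|apply/gammaWCP].
  rewrite mb_winsE (eq_mb dom) -mb_rounds_leq; split=> // k.
  by rewrite mb_winsE (eq_mb dom) -mb_rounds_leq ltnNge.
rewrite wc_winsE (eq_wc dom) -wc_rounds_leq; split=> // k.
by rewrite wc_winsE (eq_wc dom) -wc_rounds_leq ltnNge.
Qed.

(** The second hypothesis says, without subtraction, that the two parameters already differ by the
    right amount; empty gadgets then shift both together. *)
Lemma rounds_graph n (K : seq {set 'I_n}) s t :
  mb_rounds (rcons K setT) <= s ->
  mb_rounds (rcons K setT) + t = wc_rounds (rcons K setT) + s ->
  exists G : sgraph, gammaMB' G = Some s /\ gammaWC G = Some t.
Proof.
set L := rcons K setT => le eq; pose r := s - mb_rounds L.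
have [hm hw] := rounds_isolated L r.
have TL : setT \in nseq r set0 ++ L.
  by rewrite mem_cat mem_rcons mem_head orbT.
exists (graph (nseq r set0 ++ L)); rewrite !(graph_rounds TL).1 (graph_rounds TL).2.
rewrite hm hw subnK //; split=> //; congr Some; apply/eqP.
by rewrite -(eqn_add2l (mb_rounds L)) eq addnA [_ + r]addnC subnK // addnC.
Qed.

(* With u_i = i and v_i = i + 3: the triangle u_0 u_1 u_2, the triples
   u_i u_(i+1) v_i, and the triples v_(i+1) v_(i+2) u_i, indices modulo 3. It was
   found by a computer search. *)
Definition triangle_core : seq (seq nat) :=
  [:: [:: 0; 1; 2]; [:: 0; 1; 3]; [:: 1; 2; 4]; [:: 2; 0; 5];
      [:: 4; 5; 0]; [:: 5; 3; 1]; [:: 3; 4; 2]].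

(** The root is 0, its children are 1 and 2, and the leaves are 3, 4 below 1 and 5, 6 below 2. *)
Definition tree_core : seq (seq nat) :=
  [:: [:: 0; 1; 3]; [:: 0; 1; 4]; [:: 0; 2; 5]; [:: 0; 2; 6]].

Lemma triangle_mb : mb_core 6 triangle_core 3 [::] [::].
Proof. by lazy. Qed.

(** Each level uses up at least one of the 6 core vertices; the seventh is for the position with
    none left, where the quantifiers are vacuous. *)
Lemma triangle_wc : wc_resists 6 triangle_core 7 [::] [::].
Proof. by lazy. Qed.

(** Staller takes the root, then a child whose subtree is untouched, then a leaf below it. The
    fourth level is where his finished path is detected. *)
Lemma tree_mb : mb_resists 7 tree_core 4 [::] [::].
Proof. by lazy. Qed.

(** Dominator offers 3 and 5. If Staller keeps 3, she offers 2 and 6, then 0 and 1; the other case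
    is symmetric. *)
Lemma tree_wc : wc_core 7 tree_core 3 [::] [::].
Proof. by lazy. Qed.

Theorem theorem1p9 (s t : nat) (hs : 7 <= s) (ht : 7 <= t) :
  exists G : sgraph, gammaMB' G = Some s /\ gammaWC G = Some t.
Proof.
have [st|/ltnW ts] := leqP s t.
  (* This many copies of each edge push [wc_rounds] above [3 + (t - s)], while [mb_rounds] stays at
     most 3, so the difference reaches [t - s]. *)
  have [||||K' sub eq] := @intermediate _ (@wc_rounds 'I_6) (@mb_rounds 'I_6) (t - s)
      (many 6 triangle_core (3 + (t - s)).+1) setT.
  - exact: wc_rounds_up.
  - exact: mb_rounds_mono.
  - by rewrite wc_rounds_setT mb_rounds_setT leq_addr.
  - apply: leq_trans (ltnW (wc_rounds_many _ triangle_wc)).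
    by rewrite leq_add2r; apply: mb_rounds_core triangle_mb => //; apply: many_sub.
  have fast : mb_rounds (rcons K' setT) <= 3.
    by apply: (@mb_rounds_core 6 triangle_core) triangle_mb => // e /sub/many_sub.
  apply: (@rounds_graph 6 K'); first by apply: leq_trans fast _; apply: leq_trans hs.
  by rewrite eq -addnA subnK.
have [||||K' sub eq] := @intermediate _ (@mb_rounds 'I_7) (@wc_rounds 'I_7) (s - t)
    (many 7 tree_core (3 + (s - t)).+1) setT.
- exact: mb_rounds_up.
- exact: wc_rounds_mono.
- by rewrite wc_rounds_setT mb_rounds_setT leq_addr.
- apply: leq_trans (ltnW (mb_rounds_many _ tree_mb)).
  by rewrite leq_add2r; apply: wc_rounds_core tree_wc => //; apply: many_sub.
have fast : wc_rounds (rcons K' setT) <= 3.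
  by apply: (@wc_rounds_core 7 tree_core) tree_wc => // e /sub/many_sub.
apply: (@rounds_graph 7 K'); last by rewrite eq -addnA subnK.
(* Here [mb_rounds] equals [wc_rounds + (s - t)], which is at most [3 + (s - t)] and so at most
   [t + (s - t) = s]. *)
rewrite eq; apply: leq_trans (leq_add fast (leqnn _)) _.
by rewrite -[X in _ <= X](subnKC ts) leq_add2r; apply: leq_trans ht.
Qed.
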